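(* Let $\mathbf m=(m_1,\dots,m_d)\in\mathbb N^d$. The following hold. (1) For $\mathcal T=[t_{i_1,\ldots,i_d}]\in\mathbb R^{\mathbf m}$, let $|\mathcal T|=[|t_{i_1,\ldots,i_d}|]$. Then $\|\mathcal T\|_\infty\le\||\mathcal T|\|_\infty$ and $\max_{i_1\in[m_1],\dots,i_d\in[m_d]}|t_{i_1,\ldots,i_d}|\le\|\mathcal T\|_\infty$. (2) Let $\mathbf n=(n_1,\dots,n_k)\in\mathbb N^k$, $\mathcal E\in\mathbb R^{\mathbf n}$ and $\mathcal T\in\mathbb R^{\mathbf m}$. Then $\|\mathcal E\otimes\mathcal T\|_\infty=\|\mathcal E\|_\infty\|\mathcal T\|_\infty$. (3) If, with $\mathcal E$ and $\mathcal T$ as in (2), $\mathcal E$ is a subtensor of $\mathcal T$, then $\|\mathcal E\|_\infty\le\|\mathcal T\|_\infty$. (4) If $\mathcal E,\mathcal T\in\mathbb R^{\mathbf m}_+$, then $\|\mathcal E\circ\mathcal T\|_\infty\le\|\mathcal E\|_\infty\|\mathcal T\|_\infty$. (5) If $D\subset\mathbb R^m$ is a convex set and $\mathcal T:D\to\mathbb R^{\mathbf m}_+$ is logconvex, then $D\to\mathbb R_+$, $t\mapsto\|\mathcal T(t)\|_\infty$, is logconvex. (6) If $\mathcal F,\mathcal G\in\mathbb R^{\mathbf m}_+$ and $\alpha,\beta>0$ with $\alpha+\beta=1$, then $\|\mathcal F^{\circ\alpha}\circ\mathcal G^{\circ\beta}\|_\infty\le\|\mathcal F\|_\infty^\alpha\|\mathcal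 G\|_\infty^\beta$. (7) If $\mathcal T=[t_{j_1,\ldots,j_d}]\in\mathbb R^{\mathbf m}_+$, then $s\mapsto\|\mathcal T^{\circ s}\|_\infty^{1/s}$ is a nonincreasing function on $(0,\infty)$, and $$\lim_{s\to\infty}\|\mathcal T^{\circ s}\|_\infty^{1/s}=\max_{j_1\in[m_1],\ldots,j_d\in[m_d]}t_{j_1,\ldots,j_d}.$$ (8) Let $\mathcal E,\mathcal F,\mathcal T\in\mathbb R^{\mathbf m}_+$. Then $\|\mathcal E\|_\infty\le\|\mathcal F\|_\infty$ if $\mathcal E\le\mathcal F$ entrywise; moreover $\|\mathcal T\circ\mathcal E\|_\infty\le\|\mathcal T\|_\infty\|\mathcal E\|_{\ell_\infty}$ and $\|\mathcal E\|_\infty\le\|\mathrm{pat}\,\mathcal E\|_\infty\|\mathcal E\|_{\ell_\infty}$.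
   Context: $[m]=\{1,\dots,m\}$. $\mathbb R^{\mathbf m}=\mathbb R^{m_1\times\cdots\times m_d}$ is the space of real tensors $\mathcal T=[t_{i_1,\dots,i_d}]$ with $i_j\in[m_j]$, and $\mathbb R^{\mathbf m}_+$ the subset with nonnegative entries. The spectral norm is $\|\mathcal T\|_\infty=\max\left\{\left|\sum_{i_1,\dots,i_d}t_{i_1,\dots,i_d}x_{i_1,1}\cdots x_{i_d,d}\right|:\ x_j=(x_{1,j},\dots,x_{m_j,j})^\top\in\mathbb R^{m_j},\ \|x_j\|=1,\ j\in[d]\right\}$, with $\|\cdot\|$ the Euclidean norm. $\|\mathcal T\|_{\ell_\infty}=\max|t_{i_1,\dots,i_d}|$ is the $\ell_\infty$ norm of $\mathcal T$ viewed as a vector. For $\mathcal E\in\mathbb R^{\mathbf n}$, $\mathbf n=(n_1,\dots,n_k)$, $\mathcal E\otimes\mathcal T\in\mathbb R^{n_1\times\cdots\times n_k\times m_1\times\cdots\times m_d}$ is the tensor product with entries $e_{j_1,\dots,j_k}t_{i_1,\dots,i_d}$. $\mathcal E$ is a subtensor of $\mathcal T$ if $k=d$, $n_l\le m_l$ for all $l\in[d]$, and for each $l$ there is an increasing sequence $1\le i_{1,l}<\dots<i_{n_l,l}\le m_l$ such that $e_{j_1,\dots,j_d}=t_{i_{j_1,1},\dots,i_{j_d,d}}$. $\mathcal E\circ\mathcal T$ is the entrywise product; $\mathcal T^{\circ s}=[t_{i_1,\dots,i_d}^s]$ for $s>0$ and nonnegative $\mathcal T$. $\mathrm{pat}\,\mathcal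 E$ is the $0$–$1$ tensor with entry $1$ exactly where the entry of $\mathcal E$ is positive. A function $f:D\to\mathbb R_+=[0,\infty)$ on a convex set $D$ is logconvex if $\log f:D\to[-\infty,\infty)$ is continuous and convex (with $\log0=-\infty$; such an $f$ that vanishes at one point vanishes identically). A tensor-valued function on $D$ is logconvex if each of its entries is logconvex. *)

(* Defs.v *)
From HB Require Import structures.
From mathcomp Require Import all_boot all_order all_algebra.
From mathcomp Require Import all_classical all_reals all_analysis.

Set Implicit Arguments.
Unset Strict Implicit.
Unset Printing Implicit Defensive.

Import Order.TTheory GRing.Theory Num.Theory.
Import numFieldNormedType.Exports.

Local Open Scope classical_set_scope.
Local Open Scope ring_scope.

Definition idx (d : nat) (m : 'I_d -> nat) := {dffun forall j : 'I_d, 'I_(m j)}.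

Definition tensor (R : Type) (d : nat) (m : 'I_d -> nat) := {ffun idx m -> R}.

Section Norms.
Context {R : realType} {d : nat} {m : 'I_d -> nat}.
Implicit Types (T : tensor R m) (x : forall j, 'rV[R]_(m j)).

(* The canonical norm `|x| on 'rV[R]_n is the max norm, hence this one. *)
Definition eucl_norm (n : nat) (x : 'rV[R]_n) : R :=
  Num.sqrt (\sum_i x ord0 i ^+ 2).

Definition mform T x : R := \sum_(i : idx m) T i * \prod_j x j ord0 (i j).

Definition unit_vectors : set (forall j, 'rV[R]_(m j)) :=
  [set x | forall j, eucl_norm (x j) = 1].

(* A maximum whenever all dimensions are positive: see spectral_norm_max. *)
Definition spectral_norm T : R := sup [set `|mform T x| | x in unit_vectors].

(* The default value 0 is immaterial, the terms being nonnegative. *)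
Definition linf_norm T : R := \big[Num.max/0]_(i : idx m) `|T i|.

End Norms.

Lemma eucl_norm_continuous (R : realType) (n : nat) :
  continuous (@eucl_norm R n).
Proof.
move=> x; apply: (@continuous_comp _ _ _ _ (@Num.sqrt R)); last first.
  exact: sqrt_continuous.
apply: continuous_big => [|i _].
  by apply: add_continuous.
move=> {}x; apply: (@continuous_comp _ _ _ _ (fun r : R => r ^+ 2)).
  exact: coord_continuous.
exact: exprn_continuous.
Qed.

Lemma unit_sphere_compact (R : realType) (n : nat) :
  compact [set x : 'rV[R]_n | eucl_norm x = 1].
Proof.
apply: bounded_closed_compact; last first.
  rewrite (_ : [set x | _] = @eucl_norm R n @^-1` [set 1])//.
  apply: preimage_closed; first by move=> x _; exact: eucl_norm_continuous.
  exact: closed_eq.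
exists 1; split=> // M M1 x /= nx.
rewrite [leLHS]/Num.norm /= mx_normrE; apply: bigmax_le; first exact: le_trans (ltW M1).
move=> [i0 i] _ /=; apply: le_trans (ltW M1).
rewrite -nx -sqrtr_sqr ler_sqrt; last by apply: sumr_ge0 => ? _; exact: sqr_ge0.
rewrite (bigD1 i)//= (ord1 i0) lerDl.
by apply: sumr_ge0 => ? _; exact: sqr_ge0.
Qed.

Lemma unit_vectors_nonempty (R : realType) (d : nat) (m : 'I_d -> nat) :
  (forall j, (0 < m j)%N) -> @unit_vectors R d m !=set0.
Proof.
move=> m_gt0; exists (fun j => delta_mx ord0 (Ordinal (m_gt0 j))) => j.
rewrite /eucl_norm (bigD1 (Ordinal (m_gt0 j)))//= mxE !eqxx expr1n big1.
  by rewrite addr0 sqrtr1.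
by move=> i ne; rewrite mxE (negbTE ne) andbF expr0n.
Qed.

Lemma spectral_norm_max (R : realType) (d : nat) (m : 'I_d -> nat)
    (T : tensor R m) : (forall j, (0 < m j)%N) ->
  exists2 x, unit_vectors x & spectral_norm T = `|mform T x| /\
    forall y, unit_vectors y -> `|mform T y| <= `|mform T x|.
Proof.
move=> m_gt0.
pose P := prod_topology (fun j : 'I_d => 'rV[R]_(m j)).
have cU : compact (@unit_vectors R d m : set P).
  exact: (tychonoff (fun j : 'I_d => @unit_sphere_compact R (m j))).
have cf : continuous (fun x : P => `|mform T x|).
  move=> x; apply: (@continuous_comp _ _ _ _ (@Num.norm R R)); last first.
    exact: norm_continuous.
  apply: continuous_big => [|i _]; first exact: add_continuous.
  move=> {}x; apply: (@continuousM _ _ (cst (T i))); first exact: cst_continuous.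
  apply: continuous_big => [|j _]; first exact: mul_continuous.
  move=> {}x; apply: (@continuous_comp P 'rV[R]_(m j) R (proj j)
    (fun v : 'rV[R]_(m j) => v ord0 (i j))).
    exact: proj_continuous.
  exact: coord_continuous.
have [x /set_mem xU xmax] := @compact_EVT_max P R _ _
  (unit_vectors_nonempty R m_gt0) cU (continuous_subspaceT cf).
have ymax y : unit_vectors y -> `|mform T y| <= `|mform T x|.
  by move=> yU; apply: xmax; exact: mem_set.
exists x => //; split=> //; apply/eqP; rewrite eq_le; apply/andP; split.
  apply: ge_sup; first by exists `|mform T x|, x.
  by move=> _ [y yU <-]; exact: ymax.
apply: ub_le_sup; last by exists x.
by exists `|mform T x| => _ [y yU <-]; exact: ymax.
Qed.

Section Operations.
Context {R : realType} {d : nat} {m : 'I_d -> nat}.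
Implicit Types E T : tensor R m.

Definition tensor_nneg T : Prop := forall i, 0 <= T i.

Definition tensor_le E T : Prop := forall i, E i <= T i.

Definition tensor_abs T : tensor R m := [ffun i => `|T i|].

Definition hadamard E T : tensor R m := [ffun i => E i * T i].

Definition hadamard_pow T (s : R) : tensor R m := [ffun i => T i `^ s].

Definition pat T : tensor R m := [ffun i => if 0 < T i then 1 else 0].

End Operations.

Section TensorProduct.
Context {k d : nat} (n : 'I_k -> nat) (m : 'I_d -> nat).

Definition cat_dims (l : 'I_(k + d)) : nat :=
  match fintype.split l with inl a => n a | inr b => m b end.

Lemma cat_dimsl (a : 'I_k) : cat_dims (lshift d a) = n a.
Proof. by rewrite /cat_dims (unsplitK (inl a)). Qed.

Lemma cat_dimsr (b : 'I_d) : cat_dims (rshift k b) = m b.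
Proof. by rewrite /cat_dims (unsplitK (inr b)). Qed.

Definition lidx (i : idx cat_dims) : idx n :=
  [ffun a => cast_ord (cat_dimsl a) (i (lshift d a))].

Definition ridx (i : idx cat_dims) : idx m :=
  [ffun b => cast_ord (cat_dimsr b) (i (rshift k b))].

Definition otimes (R : realType) (E : tensor R n) (T : tensor R m) :
    tensor R cat_dims :=
  [ffun i => E (lidx i) * T (ridx i)].

End TensorProduct.

(* cast_ord kd l is the mode l : 'I_k read in 'I_d; the multi-index i of T is
   the one with entries f l (j l), where f l is the increasing selection of
   indices in mode l. *)
Definition subtensor (R : realType) (k d : nat)
    (n : 'I_k -> nat) (m : 'I_d -> nat) (E : tensor R n) (T : tensor R m) :=
  exists kd : k = d,
    (forall l, (n l <= m (cast_ord kd l))%N) /\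
    exists f : forall l : 'I_k, 'I_(n l) -> 'I_(m (cast_ord kd l)),
      (forall l (a b : 'I_(n l)), (a < b)%N -> (f l a < f l b)%N) /\
      (forall (j : idx n) (i : idx m),
        (forall l, i (cast_ord kd l) = f l (j l)) -> E j = T i).

(* lne is the extended logarithm, with lne 0 = -oo; in the convexity inequality
   0 * -oo = 0. *)
Definition logconvex (R : realType) (p : nat) (D : set 'rV[R]_p)
    (f : 'rV[R]_p -> R) : Prop :=
  [/\ forall t, D t -> 0 <= f t,
      {within D, continuous (fun t => lne (f t)%:E)} &
      forall (x y : convex_lmodType 'rV[R]_p) (a : {i01 R}), D x -> D y ->
        (lne (f (conv a x y))%:E <=
          a%:num%:E * lne (f x)%:E + (1 - a%:num)%:E * lne (f y)%:E)%E].

Definition tensor_logconvex (R : realType) (p : nat) (D : set 'rV[R]_p)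
    (d : nat) (m : 'I_d -> nat) (T : 'rV[R]_p -> tensor R m) : Prop :=
  forall i, logconvex D (fun t => T t i).

(* Main.v *)
Require Import Defs.
From HB Require Import structures.
From mathcomp Require Import all_boot all_order all_algebra.
From mathcomp Require Import all_classical all_reals all_analysis.

Set Implicit Arguments.
Unset Strict Implicit.
Unset Printing Implicit Defensive.

Import Order.TTheory GRing.Theory Num.Theory.
Import numFieldNormedType.Exports.

Local Open Scope classical_set_scope.
Local Open Scope ring_scope.

(* Replacing a unit vector x by |x| keeps it a unit vector, so that
   |E i| <= c * F i for all i gives ||E|| <= c * ||F||.  With the entry bound
   |T i| <= ||T|| (evaluate the form at basis vectors), this domination
   principle yields (1), (4), (8), and both halves of (7): for s <= t one has
   T^t <= T^s * (max T^s)^(t/s - 1), while M <= ||T^s||^(1/s) <= M * C^(1/s) with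
   M the maximal entry and C the norm of the all-ones tensor.
   (2): the form of a tensor product splits into the product of the two forms.
   (3): unit vectors for the subtensor are extended by zero.
   (6): Hoelder's inequality at a maximizer with nonnegative entries.
   (5): convexity is (6) applied to T(a x + (1-a) y) <= T(x)^a * T(y)^(1-a);
   continuity holds as the norm is Lipschitz in the entries. *)

(** * Forms at unit vectors: entry bounds, domination, Lipschitz dependence *)

Section SpectralNorm.
Context {R : realType} {d : nat} {m : 'I_d -> nat}.
Context (m_gt0 : forall j, (0 < m j)%N).
Implicit Types (E F T : tensor R m) (x : forall j, 'rV[R]_(m j)).

Definition abs_vec x : forall j, 'rV[R]_(m j) := fun j => map_mx Num.norm (x j).

Lemma abs_vec_unit x : unit_vectors x -> unit_vectors (abs_vec x).
Proof.
move=> xU j; rewrite -[RHS](xU j) /eucl_norm; congr Num.sqrt.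
by apply: eq_bigr => i _; rewrite mxE real_normK ?num_real.
Qed.

(** The right-hand side is the form of [tensor_abs T] at [abs_vec x], kept as a sum for termwise
    comparison. *)
Lemma norm_mform_le T x :
  `|mform T x| <= \sum_i `|T i| * \prod_j abs_vec x j ord0 (i j).
Proof.
apply: le_trans (ler_norm_sum _ _ _) _; apply: ler_sum => i _.
rewrite normrM normr_prod; apply: ler_wpM2l => //.
by apply: ler_prod => j _; rewrite mxE normr_ge0 /=.
Qed.

(** Each coordinate of a unit vector is at most 1 in absolute value. The lower bound makes the
    products nonnegative weights; the upper bound gives the Lipschitz estimate. *)
Lemma unit_vectors_prod_le1 x (i : idx m) : unit_vectors x ->
  0 <= \prod_j abs_vec x j ord0 (i j) <= 1.
Proof.
move=> /abs_vec_unit xU.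
have x_ge0 j : 0 <= abs_vec x j ord0 (i j) by rewrite mxE.
rewrite prodr_ge0//=; apply: Num.Theory.prodr_ile1 => j _.
rewrite x_ge0 /= -[leRHS](xU j) -[leLHS]ger0_norm//.
rewrite -sqrtr_sqr ler_sqrt; last by apply: sumr_ge0 => ? _; exact: sqr_ge0.
rewrite (bigD1 (i j))//= lerDl.
by apply: sumr_ge0 => ? _; exact: sqr_ge0.
Qed.

Lemma mform_le_spectral_norm T x : unit_vectors x ->
  `|mform T x| <= spectral_norm T.
Proof. by have [y _ [-> ymax]] := spectral_norm_max T m_gt0 => /ymax. Qed.

Lemma spectral_norm_le T (c : R) :
  (forall x, unit_vectors x -> `|mform T x| <= c) -> spectral_norm T <= c.
Proof. by have [y yU [-> _]] := spectral_norm_max T m_gt0 => /(_ y yU). Qed.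

Lemma spectral_norm_ge0 T : 0 <= spectral_norm T.
Proof. by have [y _ [-> _]] := spectral_norm_max T m_gt0. Qed.

Lemma mform_delta T (i : idx m) :
  mform T (fun j => delta_mx ord0 (i j)) = T i.
Proof.
rewrite /mform (bigD1 i)//= [X in _ + X]big1 ?addr0.
  by rewrite big1 ?mulr1// => j _; rewrite mxE !eqxx.
(* In a mode where [i'] differs from [i], the basis vector has coordinate 0. *)
move=> i' ne; have [j nej] : exists j, i' j != i j.
  apply/existsP; apply: contraNT ne => /existsPn h; apply/eqP/ffunP => j.
  by have /negPn/eqP := h j.
by rewrite (bigD1 j)//= mxE (negbTE nej) andbF mul0r mulr0.
Qed.

Lemma entry_le_spectral_norm T i : `|T i| <= spectral_norm T.
Proof.
rewrite -[T i in leLHS]mform_delta; apply: mform_le_spectral_norm => j.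
rewrite /eucl_norm (bigD1 (i j))//= mxE !eqxx expr1n big1 ?addr0 ?sqrtr1//.
by move=> k ne; rewrite mxE (negbTE ne) andbF expr0n.
Qed.

Lemma bigmax_entry_le_spectral_norm T :
  \big[Num.max/0]_(i : idx m) `|T i| <= spectral_norm T.
Proof.
apply: bigmax_le => [|i _]; first exact: spectral_norm_ge0.
exact: entry_le_spectral_norm.
Qed.

Lemma spectral_norm_le_scale E F (c : R) : 0 <= c ->
  (forall i, `|E i| <= c * F i) -> spectral_norm E <= c * spectral_norm F.
Proof.
move=> c0 EF; apply: spectral_norm_le => x xU.
apply: le_trans (norm_mform_le E x) _.
apply: (@le_trans _ _ (c * mform F (abs_vec x))).
  rewrite mulr_sumr; apply: ler_sum => i _; rewrite mulrA ler_wpM2r//.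
  by have /andP[] := unit_vectors_prod_le1 i xU.
apply: ler_wpM2l => //; apply: le_trans (ler_norm _) _.
by apply: mform_le_spectral_norm; exact: abs_vec_unit.
Qed.

Lemma spectral_norm_mono E F : (forall i, `|E i| <= F i) ->
  spectral_norm E <= spectral_norm F.
Proof.
move=> EF; rewrite -[leRHS]mul1r; apply: spectral_norm_le_scale => // i.
by rewrite mul1r.
Qed.

(** The form is linear in the tensor, so two forms differ by the form of the difference tensor,
    which on unit vectors is at most the sum of the absolute entries. *)
Lemma spectral_norm_lipschitz E F :
  `|spectral_norm E - spectral_norm F| <= \sum_i `|E i - F i|.
Proof.
have main E' F' : spectral_norm E' <= spectral_norm F' + \sum_i `|E' i - F' i|.
  apply: spectral_norm_le => x xU.
  rewrite -[mform E' x](subrKC (mform F' x)).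
  apply: le_trans (ler_normD _ _) _; apply: lerD.
    exact: mform_le_spectral_norm.
  rewrite (_ : _ - _ = mform [ffun i => E' i - F' i] x).
    apply: le_trans (norm_mform_le _ _) _.
    apply: ler_sum => i _; rewrite ffunE ler_piMr//.
    by have /andP[] := unit_vectors_prod_le1 i xU.
  by rewrite /mform -sumrB; apply: eq_bigr => i _; rewrite ffunE mulrBl.
(* [main] bounds the difference from above and, with the tensors exchanged, from below. *)
rewrite ler_norml lerBlDl main andbT lerBrDl lerBlDr.
by under eq_bigr do rewrite distrC; exact: main.
Qed.

End SpectralNorm.

(** * Subtensors: extension of vectors by zero *)

Local Open Scope ring_scope.

(** Serves both for the coordinates of one vector and for the multi-indices of a tensor. *)
Lemma big_support_inj (V : nmodType) (I J : finType) (h : I -> J) (F : J -> V) :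
  injective h -> (forall j, j \notin codom h -> F j = 0) ->
  \sum_j F j = \sum_i F (h i).
Proof.
move=> h_inj F0; rewrite (bigID [in [set h i | i in I]%SET])/=.
rewrite big_imset/=; last by move=> ? ? _ _; exact: h_inj.
rewrite [X in _ + X]big1 ?addr0// => j jh; apply: F0; apply: contraNN jh.
by move=> /codomP[i ->]; exact: imset_f.
Qed.

(** Extension by zero along an injective [h]; summing over the fibres avoids choosing a partial
    inverse. *)
Definition push_vec (R : realType) (n p : nat) (h : 'I_n -> 'I_p)
    (x : 'rV[R]_n) : 'rV[R]_p :=
  \row_b \sum_(a | h a == b) x ord0 a.

Lemma push_vec_inj (R : realType) (n p : nat) (h : 'I_n -> 'I_p)
  (x : 'rV[R]_n) (a : 'I_n) : injective h -> push_vec h x ord0 (h a) = x ord0 a.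
Proof.
by move=> h_inj; rewrite mxE (eq_bigl (xpred1 a)) ?big_pred1_eq// => b; exact: inj_eq.
Qed.

Lemma push_vec_notin (R : realType) (n p : nat) (h : 'I_n -> 'I_p)
  (x : 'rV[R]_n) (b : 'I_p) : b \notin codom h -> push_vec h x ord0 b = 0.
Proof.
move=> bh; rewrite mxE big1// => a /eqP hab.
by rewrite -hab codom_f in bh.
Qed.

Lemma eucl_norm_push_vec (R : realType) (n p : nat) (h : 'I_n -> 'I_p)
  (x : 'rV[R]_n) : injective h -> eucl_norm (push_vec h x) = eucl_norm x.
Proof.
move=> h_inj; congr Num.sqrt; rewrite (big_support_inj h_inj).
  by apply: eq_bigr => a _; rewrite push_vec_inj.
by move=> b bh; rewrite push_vec_notin// expr0n.
Qed.

Lemma spectral_norm_reindex (R : realType) (d : nat) (n m : 'I_d -> nat)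
    (f : forall l, 'I_(n l) -> 'I_(m l)) (E : tensor R n) (T : tensor R m) :
  (forall l, (0 < n l)%N) -> (forall l, (0 < m l)%N) ->
  (forall l, injective (f l)) ->
  (forall j : idx n, E j = T [ffun l => f l (j l)]) ->
  spectral_norm E <= spectral_norm T.
Proof.
move=> n_gt0 m_gt0 f_inj ET; apply: spectral_norm_le => // x xU.
rewrite (_ : mform E x = mform T (fun l => push_vec (f l) (x l))).
  apply: mform_le_spectral_norm => // l.
  by rewrite eucl_norm_push_vec//; exact: xU.
pose h (j : idx n) : idx m := [ffun l => f l (j l)].
have h_inj : injective h.
  move=> j1 j2 /ffunP h12; apply/ffunP => l.
  by have := h12 l; rewrite !ffunE => /f_inj.
rewrite /mform [RHS](big_support_inj h_inj).
  apply: eq_bigr => j _; rewrite ET; congr (_ * _); apply: eq_bigr => l _.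
  by rewrite ffunE push_vec_inj.
(* If every coordinate of [i] is hit, then [i] is in the image of [h]; otherwise some factor of the
   product is 0. *)
move=> i; have [/forallP ih|/forallPn[l lh] _] :=
    boolP [forall l, i l \in codom (f l)].
  case/negP; apply/codomP.
  exists [ffun l => iinv (ih l)]; apply/ffunP => l.
  by rewrite !ffunE f_iinv.
by rewrite (bigD1 l)//= push_vec_notin// mul0r mulr0.
Qed.

Lemma spectral_norm_subtensor (R : realType) (k d : nat) (n : 'I_k -> nat)
    (m : 'I_d -> nat) (E : tensor R n) (T : tensor R m) :
  (forall l, (0 < n l)%N) -> (forall l, (0 < m l)%N) ->
  subtensor E T -> spectral_norm E <= spectral_norm T.
Proof.
move=> n_gt0 m_gt0 [kd]; subst d => -[_ [f [f_incr ET]]].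
(* [cast_ord erefl l] equals [l] only provably, so [f l] is transported to a map into ['I_(m l)]. *)
pose g l : 'I_(n l) -> 'I_(m l) := fun a =>
  cast_ord (congr1 m (cast_ord_id (erefl k) l)) (f l a).
apply: (@spectral_norm_reindex _ _ _ _ g) => // [l a b gab|j].
  have fab : nat_of_ord (f l a) = f l b := congr1 val gab.
  apply/val_inj; case: (ltngtP a b) => // /f_incr; first by rewrite fab ltnn.
  by rewrite fab ltnn.
apply: ET => l; rewrite ffunE; apply/val_inj.
(* A free [l'] in place of the cast index can be rewritten even though the types depend on it. *)
have gE l' : l' = l -> val (g l' (j l')) = val (f l (j l)) by move=> ->.
exact/gE/cast_ord_id.
Qed.

(** * Tensor products: multiplicativity of the norm *)

Section TensorProductNorm.
Context {R : realType} {k d : nat} {n : 'I_k -> nat} {m : 'I_d -> nat}.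

Definition lvec (z : forall l, 'rV[R]_(cat_dims n m l)) (a : 'I_k) :
    'rV[R]_(n a) :=
  \row_i z (lshift d a) ord0 (cast_ord (esym (cat_dimsl n m a)) i).

Definition rvec (z : forall l, 'rV[R]_(cat_dims n m l)) (b : 'I_d) :
    'rV[R]_(m b) :=
  \row_i z (rshift k b) ord0 (cast_ord (esym (cat_dimsr n m b)) i).

(* The vectors are built mode by mode from a specification up to nat_of_ord,
   which avoids a transport along the match in cat_dims. *)
Lemma lvec_rvec_surj (x : forall a, 'rV[R]_(n a)) (y : forall b, 'rV[R]_(m b)) :
  exists z, lvec z = x /\ rvec z = y.
Proof.
have zP (l : 'I_(k + d)) : exists v : 'rV[R]_(cat_dims n m l),
    (forall a (i : 'I_(cat_dims n m l)) (i' : 'I_(n a)),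
      l = lshift d a -> i = i' :> nat -> v ord0 i = x a ord0 i') /\
    (forall b (i : 'I_(cat_dims n m l)) (i' : 'I_(m b)),
      l = rshift k b -> i = i' :> nat -> v ord0 i = y b ord0 i').
  rewrite -[l](splitK); case: (fintype.split l) => [a|b] /=.
    exists (\row_i x a ord0 (cast_ord (cat_dimsl n m a) i)).
    split=> [a' i i' /lshift_inj aa'|b i i' /eqP]; last by rewrite eq_lrshift.
    by subst a' => ii'; rewrite mxE; congr (x a ord0 _); exact: val_inj.
  exists (\row_i y b ord0 (cast_ord (cat_dimsr n m b) i)).
  split=> [a i i' /eqP|b' i i' /rshift_inj bb']; first by rewrite eq_rlshift.
  by subst b' => ii'; rewrite mxE; congr (y b ord0 _); exact: val_inj.
have [z zP'] := all_sig (fun l => cid (zP l)); exists z; split.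
  apply: functional_extensionality_dep => a; apply/rowP => i; rewrite mxE.
  exact: (zP' _).1.
apply: functional_extensionality_dep => b; apply/rowP => i; rewrite mxE.
exact: (zP' _).2.
Qed.
End TensorProductNorm.

Section OtimesNorm.
Context {R : realType} {k d : nat} {n : 'I_k -> nat} {m : 'I_d -> nat}.

(** For surjectivity the coordinates of a preimage are specified by their values in [nat], as their
    types depend on a match. A right inverse is then chosen, and injectivity makes it two-sided. *)
Lemma lidx_ridx_bij : bijective (fun i : idx (cat_dims n m) => (lidx i, ridx i)).
Proof.
set h := fun i => _.
have h_inj : injective h.
  move=> i1 i2 [/ffunP hl /ffunP hr]; apply/ffunP => l.
  rewrite -[l]splitK; case: (fintype.split l) => [a|b] /=.
    by have := hl a; rewrite !ffunE => /cast_ord_inj.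
  by have := hr b; rewrite !ffunE => /cast_ord_inj.
have hP (p : idx n * idx m) : exists i, h i = p.
  have iP (l : 'I_(k + d)) : exists i : 'I_(cat_dims n m l),
      (forall a, l = lshift d a -> i = p.1 a :> nat) /\
      (forall b, l = rshift k b -> i = p.2 b :> nat).
    rewrite -[l](splitK); case: (fintype.split l) => [a|b] /=.
      exists (cast_ord (esym (cat_dimsl n m a)) (p.1 a)).
      split=> [a' /lshift_inj -> //|b /eqP]; by rewrite eq_lrshift.
    exists (cast_ord (esym (cat_dimsr n m b)) (p.2 b)).
    split=> [a /eqP|b' /rshift_inj -> //]; by rewrite eq_rlshift.
  have [i iE] := all_sig (fun l => cid (iP l)).
  exists [ffun l => i l]; case: p {iP} iE => p1 p2 /= iE.
  congr pair; apply/ffunP => l; rewrite !ffunE; apply: val_inj => /=.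
    exact: (iE _).1.
  exact: (iE _).2.
have [g gK] := all_sig (fun p => cid (hP p)).
by exists g => //; exact: inj_can_sym.
Qed.

(** The product of the two sums is a sum over pairs of multi-indices, reindexed by [lidx_ridx_bij];
    the product over all modes splits after the first [k]. *)
Lemma mform_otimes (E : tensor R n) (T : tensor R m) z :
  mform (otimes E T) z = mform E (lvec z) * mform T (rvec z).
Proof.
rewrite /mform mulr_suml; under [RHS]eq_bigr do rewrite mulr_sumr.
rewrite pair_big/= [RHS](reindex _ (onW_bij _ lidx_ridx_bij))/=.
apply: eq_bigr => i _; rewrite ffunE mulrACA big_split_ord/=.
congr (_ * (_ * _)); apply: eq_bigr => l _; rewrite !mxE ffunE.
  by rewrite cast_ordK.
by rewrite cast_ordK.
Qed.

(** With [q] a variable, the equation can be substituted away; [lvec] and [rvec] are instances. *)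
Lemma eucl_norm_cast (p q : nat) (e : p = q) (u : 'rV[R]_p) :
  eucl_norm (\row_i u ord0 (cast_ord (esym e) i)) = eucl_norm u.
Proof.
by subst q; congr eucl_norm; apply/rowP => i; rewrite mxE cast_ord_id.
Qed.

Lemma unit_vectors_cat z : unit_vectors z <->
  unit_vectors (@lvec R k d n m z) /\ unit_vectors (@rvec R k d n m z).
Proof.
split=> [zU|[lU rU] l].
  by split=> l; rewrite eucl_norm_cast; exact: zU.
rewrite -[l]splitK; case: (fintype.split l) => [a|b] /=.
  by rewrite -[RHS](lU a) eucl_norm_cast.
by rewrite -[RHS](rU b) eucl_norm_cast.
Qed.

Lemma spectral_norm_otimes (E : tensor R n) (T : tensor R m) :
  (forall l, (0 < n l)%N) -> (forall j, (0 < m j)%N) ->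
  spectral_norm (otimes E T) = spectral_norm E * spectral_norm T.
Proof.
move=> n_gt0 m_gt0.
have nm_gt0 l : (0 < cat_dims n m l)%N.
  by rewrite /cat_dims; case: fintype.split.
apply/eqP; rewrite eq_le; apply/andP; split.
  apply: spectral_norm_le => // z /unit_vectors_cat[lU rU].
  rewrite mform_otimes normrM; apply: ler_pM => //.
    exact: mform_le_spectral_norm.
  exact: mform_le_spectral_norm.
(* For the lower bound, maximizers of both factors are concatenated into one family [z]. *)
have [x xU [-> _]] := spectral_norm_max E n_gt0.
have [y yU [-> _]] := spectral_norm_max T m_gt0.
have [z [zx zy]] := lvec_rvec_surj x y.
rewrite -normrM -zx -zy -mform_otimes; apply: mform_le_spectral_norm => //.
by apply/unit_vectors_cat; rewrite zx zy.
Qed.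

End OtimesNorm.

(** * Hoelder's inequality for weighted geometric means of tensors *)

Section Hoelder.
Context {R : realType}.

(** Induction on the list: the two-term inequality [hoelder2], with exponents 1/a and 1/b, is
    applied to the head and the tail sum. *)
Lemma hoelder_sum (I : Type) (s : seq I) (f g : I -> R) (a b : R) :
  0 < a -> 0 < b -> a + b = 1 -> (forall i, 0 <= f i) -> (forall i, 0 <= g i) ->
  \sum_(i <- s) f i `^ a * g i `^ b <=
    (\sum_(i <- s) f i) `^ a * (\sum_(i <- s) g i) `^ b.
Proof.
move=> a0 b0 ab f0 g0; elim: s => [|i s ih].
  by rewrite !big_nil powR0 ?gt_eqF// mul0r.
rewrite !big_cons; apply: le_trans (lerD (lexx _) ih) _.
have sf0 : 0 <= \sum_(j <- s) f j by apply: sumr_ge0.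
have sg0 : 0 <= \sum_(j <- s) g j by apply: sumr_ge0.
have := @hoelder2 R (f i `^ a) ((\sum_(j <- s) f j) `^ a) (g i `^ b)
  ((\sum_(j <- s) g j) `^ b) a^-1 b^-1.
rewrite !invrK -!powRrM !divff ?gt_eqF// !powRr1//.
by apply; rewrite ?powR_ge0 ?invr_gt0.
Qed.

Context {d : nat} {m : 'I_d -> nat} (m_gt0 : forall j, (0 < m j)%N).

Lemma spectral_norm_hoelder (F G : tensor R m) (a b : R) :
  tensor_nneg F -> tensor_nneg G -> 0 < a -> 0 < b -> a + b = 1 ->
  spectral_norm (hadamard (hadamard_pow F a) (hadamard_pow G b)) <=
    spectral_norm F `^ a * spectral_norm G `^ b.
Proof.
move=> F0 G0 a0 b0 ab; apply: spectral_norm_le => // x xU.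
apply: le_trans (norm_mform_le _ x) _.
pose w (i : idx m) := \prod_j abs_vec x j ord0 (i j).
have w0 i : 0 <= w i by have /andP[] := unit_vectors_prod_le1 i xU.
(* The weight is shared out as w = w^a * w^b, since a + b = 1. *)
rewrite (eq_bigr (fun i => (F i * w i) `^ a * (G i * w i) `^ b)); last first.
  move=> i _; rewrite !ffunE ger0_norm ?mulr_ge0 ?powR_ge0// !powRM//.
  by rewrite mulrACA -powRD ab ?powRr1// oner_eq0.
have {}w_le (T : tensor R m) : tensor_nneg T ->
    0 <= \sum_i T i * w i <= spectral_norm T.
  move=> T0; rewrite sumr_ge0/=; last by move=> i _; exact: mulr_ge0.
  apply: le_trans (ler_norm _) _.
  exact/(mform_le_spectral_norm m_gt0)/abs_vec_unit.
apply: le_trans (hoelder_sum _ a0 b0 ab _ _) _.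
- by move=> i; exact: mulr_ge0.
- by move=> i; exact: mulr_ge0.
have /andP[? ?] := w_le F F0; have /andP[? ?] := w_le G G0.
apply: ler_pM; rewrite ?powR_ge0//.
  by apply: ge0_ler_powR; rewrite ?nnegrE ?spectral_norm_ge0 ?(ltW a0) ?(ltW b0).
by apply: ge0_ler_powR; rewrite ?nnegrE ?spectral_norm_ge0 ?(ltW a0) ?(ltW b0).
Qed.

End Hoelder.

(** * Entrywise powers: monotonicity and limit *)

Section Powers.
Context {R : realType} {d : nat} {m : 'I_d -> nat}.
Context (m_gt0 : forall j, (0 < m j)%N).
Implicit Types T : tensor R m.

Lemma spectral_norm_pow_mono T (s t : R) : tensor_nneg T -> 0 < s -> s <= t ->
  spectral_norm (hadamard_pow T t) `^ t^-1 <=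
    spectral_norm (hadamard_pow T s) `^ s^-1.
Proof.
move=> T0 s0; rewrite le_eqVlt => /predU1P[<-//|st].
have t0 : 0 < t := lt_trans s0 st.
set N := spectral_norm (hadamard_pow T s).
have N0 : 0 <= N by exact: spectral_norm_ge0.
have r0 : 0 < t / s by rewrite divr_gt0.
have r1 : 0 <= t / s - 1 by rewrite subr_ge0 ler_pdivlMr// mul1r ltW.
(* Both sides become powers with exponent 1/t, leaving ||T^t|| <= N^(t/s). *)
have -> : s^-1 = (t / s) * t^-1 by rewrite mulrAC divff ?mul1r// gt_eqF.
rewrite powRrM; apply: ge0_ler_powR.
- by rewrite invr_ge0 ltW.
- by rewrite nnegrE spectral_norm_ge0.
- by rewrite nnegrE powR_ge0.
(* Domination with constant N^(t/s - 1): entrywise T^t = (T^s)^(t/s - 1) * T^s, and N bounds the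
   entries of T^s. *)
rewrite -(mulr_powRB1 N0 r0) mulrC.
apply: spectral_norm_le_scale => // [|i]; first exact: powR_ge0.
rewrite !ffunE ger0_norm ?powR_ge0//.
have -> : T i `^ t = (T i `^ s) `^ (t / s).
  by rewrite -powRrM mulrC divfK// gt_eqF.
rewrite -(mulr_powRB1 (powR_ge0 _ _) r0) mulrC ler_wpM2r ?powR_ge0//.
apply: ge0_ler_powR; rewrite ?nnegrE ?powR_ge0//.
have := entry_le_spectral_norm m_gt0 (hadamard_pow T s) i.
by rewrite ffunE ger0_norm ?powR_ge0.
Qed.

Lemma cvg_powR_inv_pinfty (c : R) : 0 < c -> c `^ s^-1 @[s --> +oo] --> (1 : R).
Proof.
move=> c0; rewrite (_ : (fun s : R => c `^ s^-1) = (fun s => expR (s^-1 * ln c))); last first.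
  by apply/funext => s;  rewrite /powR gt_eqF.
rewrite -expR0; apply: continuous_cvg; first exact: continuous_expR.
rewrite -(mul0r (ln c)); apply: cvgMr_tmp.
apply/(@gtr0_cvgV0 _ _ _ _ (fun s : R => s)); last exact: cvg_id.
exact: nbhs_pinfty_gt.
Qed.

Lemma spectral_norm_pow_cvg T : tensor_nneg T ->
  spectral_norm (hadamard_pow T s) `^ s^-1 @[s --> +oo] -->
    \big[Num.max/0]_(i : idx m) T i.
Proof.
move=> T0; set M := \big[Num.max/0]_i T i.
have TM i : T i <= M by exact: le_bigmax.
pose C := spectral_norm ([ffun=> 1] : tensor R m).
(* Positivity of [C] makes its s-th root tend to 1. *)
have C0 : 0 < C.
  pose i0 : idx m := [ffun j => Ordinal (m_gt0 j)].
  apply: lt_le_trans (entry_le_spectral_norm m_gt0 _ i0).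
  by rewrite ffunE normr1.
have M0 : 0 <= M by exact: bigmax_ge_id.
apply: (@squeeze_cvgr _ _ _ _ (cst M) (fun s => M * C `^ s^-1)).
- near=> s.
  have s0 : 0 < s by near: s; exact: nbhs_pinfty_gt.
  have powK u : 0 <= u -> (u `^ s) `^ s^-1 = u.
    by move=> u0; rewrite -powRrM divff ?gt_eqF// powRr1.
  apply/andP; split.
    apply: bigmax_le => [|i _]; first exact: powR_ge0.
    rewrite -[leLHS]powK//; apply: ge0_ler_powR.
    - by rewrite invr_ge0 ltW.
    - by rewrite nnegrE powR_ge0.
    - by rewrite nnegrE spectral_norm_ge0.
    have := entry_le_spectral_norm m_gt0 (hadamard_pow T s) i.
    by rewrite ffunE ger0_norm ?powR_ge0.
  (* The upper bound is rewritten as (M^s * C)^(1/s), so that T^s is dominated by M^s times the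
     all-ones tensor. *)
  rewrite -[X in X * _]powK// -powRM ?powR_ge0 ?(ltW C0)//.
  apply: ge0_ler_powR.
  - by rewrite invr_ge0 ltW.
  - by rewrite nnegrE spectral_norm_ge0.
  - by rewrite nnegrE mulr_ge0 ?powR_ge0 ?ltW.
  apply: spectral_norm_le_scale => // [|i]; first exact: powR_ge0.
  rewrite !ffunE mulr1 ger0_norm ?powR_ge0//.
  by apply: ge0_ler_powR; rewrite ?nnegrE ?(ltW s0).
- exact: cvg_cst.
- rewrite -[X in _ --> X]mulr1; apply: cvgMl_tmp.
  exact: cvg_powR_inv_pinfty.
Unshelve. all: by end_near. Qed.

End Powers.

(** * Logconvexity of the spectral norm *)

Section LogConvex.
Context {R : realType}.

(** If [v] or [w] is 0, the two right-hand sides are -oo and 0, because [a] and [b] are positive,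
    and both inequalities say u = 0. *)
Lemma lne_le_powR (u v w a b : R) : 0 <= u -> 0 <= v -> 0 <= w ->
  0 < a -> 0 < b ->
  (lne u%:E <= a%:E * lne v%:E + b%:E * lne w%:E)%E = (u <= v `^ a * w `^ b).
Proof.
move=> u0 v0 w0 a0 b0.
have lne0 : lne (0 : R)%:E = -oo%E by rewrite le0_lneNy.
have lneNy (x : R) : 0 <= x -> (lne x%:E <= -oo)%E = (x <= 0).
  rewrite le_eqVlt => /predU1P[<-|x0]; first by rewrite lne0 !lexx.
  by rewrite lne_EFin// leeNy_eq /= leNgt x0.
move: v0; rewrite le_eqVlt => /predU1P[<-|v0].
  rewrite lne0 gt0_muleNy ?lte_fin// addNye.
  by rewrite powR0 ?gt_eqF// mul0r lneNy.
move: w0; rewrite le_eqVlt => /predU1P[<-|w0].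
  rewrite lne0 gt0_muleNy ?lte_fin// addeNy.
  by rewrite powR0 ?gt_eqF// mulr0 lneNy.
rewrite (lne_EFin v0) (lne_EFin w0); move: u0; rewrite le_eqVlt => /predU1P[<-|u0].
  by rewrite lne0 leNye mulr_ge0 ?powR_ge0.
rewrite lne_EFin// -!EFinM -EFinD lee_fin -!ln_powR -lnM ?posrE ?powR_gt0//.
by rewrite ler_ln// posrE mulr_gt0 ?powR_gt0.
Qed.

(** Reduces continuity of the extended logarithm to that of the function itself. For l > 0, exp and
    ln are continuous; for l = 0, tending to -oo is compared with tending to 0. *)
Lemma lne_cvgP (T : Type) (F : set_system T) (FF : Filter F) (g : T -> R)
    (l : R) : (\forall x \near F, 0 <= g x) -> 0 <= l ->
  lne (g x)%:E @[x --> F] --> lne l%:E <-> g x @[x --> F] --> l.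
Proof.
move=> g0; rewrite le_eqVlt => /predU1P[<-|l0].
  rewrite le0_lneNy//; split=> [/cvgeNyPlt gNy|gl].
    apply/cvgrPdist_lt => e e0; near=> x.
    have gx0 : 0 <= g x by near: x.
    rewrite sub0r normrN ger0_norm//.
    have : (lne (g x)%:E < lne e%:E)%E.
      by rewrite (lne_EFin e0); near: x; exact: gNy.
    by rewrite lte_lne// in_itv/= lee_fin leey ?gx0 ?(ltW e0).
  apply/cvgeNyPlt => A; near=> x.
  have gx0 : 0 <= g x by near: x.
  have : g x < expR A by near: x; apply: cvgr_lt; [exact: gl|exact: expR_gt0].
  rewrite -[A in (_ < A%:E)%E]expRK -lne_EFin ?expR_gt0// -lte_fin.
  by rewrite lte_lne// in_itv/= lee_fin leey ?gx0 ?expR_ge0.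
rewrite lne_EFin//; split=> [/fine_cvgP[gfin gl]|gl].
  rewrite -(lnK l0); apply: cvg_trans (continuous_cvg _ (@continuous_expR R _) gl).
  apply: near_eq_cvg; near=> x => /=.
  have : lne (g x)%:E \is a fin_num by near: x.
  rewrite /lne; case: ifPn => //; rewrite -ltNge => gx0 _.
  by rewrite lnK.
apply/fine_cvgP; split.
  near=> x; rewrite lne_EFin//.
  by near: x; apply: cvgr_gt; [exact: gl|].
apply: cvg_trans (continuous_cvg _ (continuous_ln l0) gl).
apply: near_eq_cvg; near=> x; rewrite [RHS]/comp lne_EFin//.
by near: x; apply: cvgr_gt; [exact: gl|].
Unshelve. all: by end_near. Qed.

Lemma spectral_norm_logconvex (p d : nat) (m : 'I_d -> nat) (D : set 'rV[R]_p)
    (T : 'rV[R]_p -> tensor R m) : (forall j, (0 < m j)%N) ->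
  convex_set (D : set (convex_lmodType 'rV[R]_p)) ->
  (forall t, D t -> tensor_nneg (T t)) -> tensor_logconvex D T ->
  logconvex D (fun t => spectral_norm (T t)).
Proof.
move=> m_gt0 cD T0 lT; split=> [t _||x y a Dx Dy].
- exact: spectral_norm_ge0.
- apply/subspace_continuousP => x Dx.
  apply/lne_cvgP; [by near=> t; exact: spectral_norm_ge0|exact: spectral_norm_ge0|].
  apply/subr_cvg0/norm_cvg0P.
  apply: (@squeeze_cvgr _ _ _ _ (cst 0) (fun t => \sum_i `|T t i - T x i|)).
  + by near=> t; rewrite normr_ge0 spectral_norm_lipschitz.
  + exact: cvg_cst.
  rewrite -[X in _ --> X](@big1_eq R 0 +%R _ (index_enum (idx m)) xpredT); apply: cvg_big => [|i _].
    exact: add_continuous.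
  apply/norm_cvg0P/subr_cvg0; have [_ /subspace_continuousP/(_ x Dx) cT _] := lT i.
  apply/lne_cvgP; [|exact: T0|exact: cT].
  by apply: (filterS (P := D)) => [t /T0|]; [exact|exact: withinT].
(* The endpoints are treated apart, as [lne_le_powR] takes positive weights; there 0 * -oo = 0 makes
   the inequality an equality. *)
have [a0|a0] := eqVneq a%:num 0.
  have -> : a = 0%:i01 by exact/val_inj.
  by rewrite conv0 /= mul0e add0e subr0 mul1e.
have [a1|a1] := eqVneq a%:num 1.
  have -> : a = 1%:i01 by exact/val_inj.
  by rewrite conv1 /= mul1e subrr mul0e adde0.
have {}a0 : 0 < a%:num by rewrite lt_neqAle eq_sym a0 ge0.
have {}a1 : 0 < 1 - a%:num by rewrite subr_gt0 lt_neqAle a1 le1.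
have Dxy : D (conv a x y).
  by apply/set_mem; apply: cD; exact/mem_set.
rewrite lne_le_powR ?spectral_norm_ge0//.
apply: le_trans (spectral_norm_hoelder m_gt0 (T0 _ Dx) (T0 _ Dy) a0 a1 (subrKC _ _)).
apply: spectral_norm_mono => // i; rewrite !ffunE ger0_norm; last exact: T0.
rewrite -lne_le_powR//; try exact: T0.
by have [_ _] := lT i; apply.
Unshelve. all: by end_near. Qed.

End LogConvex.

Theorem theorem31 (R : realType) (d : nat) (m : 'I_d -> nat)
    (d_gt0 : (0 < d)%N) (m_gt0 : forall j, (0 < m j)%N) :
  (* (1) *)
  (forall T : tensor R m,
    spectral_norm T <= spectral_norm (tensor_abs T) /\
    \big[Num.max/0]_(i : idx m) `|T i| <= spectral_norm T) /\
  (* (2) *)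
  (forall (k : nat) (n : 'I_k -> nat),
    (0 < k)%N -> (forall l, (0 < n l)%N) ->
    forall (E : tensor R n) (T : tensor R m),
    spectral_norm (otimes E T) = spectral_norm E * spectral_norm T) /\
  (* (3) *)
  (forall (k : nat) (n : 'I_k -> nat),
    (0 < k)%N -> (forall l, (0 < n l)%N) ->
    forall (E : tensor R n) (T : tensor R m),
    subtensor E T -> spectral_norm E <= spectral_norm T) /\
  (* (4) *)
  (forall E T : tensor R m, tensor_nneg E -> tensor_nneg T ->
    spectral_norm (hadamard E T) <= spectral_norm E * spectral_norm T) /\
  (* (5) *)
  (forall (p : nat) (D : set 'rV[R]_p) (T : 'rV[R]_p -> tensor R m),
    (0 < p)%N -> convex_set (D : set (convex_lmodType 'rV[R]_p)) ->
    (forall t, D t -> tensor_nneg (T t)) -> tensor_logconvex D T ->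
    logconvex D (fun t => spectral_norm (T t))) /\
  (* (6) *)
  (forall (F G : tensor R m) (a b : R),
    tensor_nneg F -> tensor_nneg G -> 0 < a -> 0 < b -> a + b = 1 ->
    spectral_norm (hadamard (hadamard_pow F a) (hadamard_pow G b)) <=
      spectral_norm F `^ a * spectral_norm G `^ b) /\
  (* (7) *)
  (forall T : tensor R m, tensor_nneg T ->
    (forall s t : R, 0 < s -> s <= t ->
      spectral_norm (hadamard_pow T t) `^ t^-1 <=
        spectral_norm (hadamard_pow T s) `^ s^-1) /\
    (fun s : R => spectral_norm (hadamard_pow T s) `^ s^-1) @ +oo -->
      \big[Num.max/0]_(i : idx m) T i) /\
  (* (8) *)
  (forall E F T : tensor R m,
    tensor_nneg E -> tensor_nneg F -> tensor_nneg T ->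
    (tensor_le E F -> spectral_norm E <= spectral_norm F) /\
    spectral_norm (hadamard T E) <= spectral_norm T * linf_norm E /\
    spectral_norm E <= spectral_norm (pat E) * linf_norm E).
Proof.
have norm_le (E F : tensor R m) (c : R) : 0 <= c ->
    (forall i, `|E i| <= c * F i) -> spectral_norm E <= c * spectral_norm F.
  exact: spectral_norm_le_scale.
have le_linf (T : tensor R m) i : `|T i| <= linf_norm T.
  exact: (le_bigmax _ (fun i => `|T i|)).
have linf_ge0 (T : tensor R m) : 0 <= linf_norm T by exact: bigmax_ge_id.
refine (conj _ (conj _ (conj _ (conj _ (conj _ (conj _ (conj _ _))))))).
- move=> T; split; last exact: bigmax_entry_le_spectral_norm.
  by apply: spectral_norm_mono => // i; rewrite ffunE.
- by move=> k n _ n_gt0 E T; exact: spectral_norm_otimes.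
- by move=> k n _ n_gt0 E T; exact: spectral_norm_subtensor.
(* Domination with c = ||E||, which bounds every entry of [E]. *)
- move=> E T E0 T0; apply: norm_le => [|i]; first exact: spectral_norm_ge0.
  rewrite ffunE normrM (ger0_norm (T0 i)) ler_wpM2r//.
  exact: entry_le_spectral_norm.
- by move=> p D T _ cD T0 lT; exact: spectral_norm_logconvex.
- by move=> F G a b; exact: spectral_norm_hoelder.
- move=> T T0; split; last exact: spectral_norm_pow_cvg.
  by move=> s t; exact: spectral_norm_pow_mono.
move=> E F T E0 F0 T0; split; [|split].
- move=> EF; apply: spectral_norm_mono => // i.
  by rewrite ger0_norm; [exact: EF|exact: E0].
- rewrite mulrC; apply: norm_le => // i.
  by rewrite ffunE normrM mulrC (ger0_norm (T0 i)) ler_wpM2r.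
- rewrite mulrC; apply: norm_le => // i; rewrite ffunE; case: ifPn => [_|].
    by rewrite mulr1.
  (* Where the pattern is 0 the entry is not positive, hence 0 by nonnegativity. *)
  by rewrite -leNgt mulr0 normr_le0 => Ei; rewrite eq_le Ei E0.
Qed.
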